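(* A section of the real line bundle $L\to\mathrm{P}C$ extends to a global holomorphic section of $L^{\mathbb{C}}\to\mathrm{P}C^{\mathbb{C}}$ if and only if it is of the form $s_w$ (restricted to $\mathrm{P}C$) for some imaginary split octonion $w\in\mathbb{I}$, which is then unique. Thus $\mathbb{I}$ is isomorphic, via $w\mapsto s_w$, to the space of sections of $L$ over $\mathrm{P}C$ that extend to holomorphic sections of $L^{\mathbb{C}}$ over all of $\mathrm{P}C^{\mathbb{C}}$.
   Context: $\mathbb{H}$ denotes the quaternions. The split octonions $\mathbb{O}'$ are the real vector space $\mathbb{H}\oplus\mathbb{H}$ with product $(a,b)(c,d)=(ac+d\overline{b},\,\overline{a}d+cb)$ and quadratic form $Q(a,b)=|a|^2-|b|^2$; the imaginary split octonions are $\mathbb{I}=\mathrm{Im}(\mathbb{H})\oplus\mathbb{H}$. The dot product is the symmetric bilinear form with $x\cdot x=Q(x)$. Let $\mathbb{I}^{\mathbb{C}}=\mathbb{C}\otimes\mathbb{I}$ (imaginary bioctonions), with $Q$ and the dot product extended complex-(bi)linearly. $C=\{x\in\mathbb{I}:Q(x)=0\}$, $\mathrm{P}C=\{x\in C:x\ne0\}/\mathbb{R}^*$, a real projective quadric; $C^{\mathbb{C}}=\{x\in\mathbb{I}^{\mathbb{C}}:Q(x)=0\}$, $\mathrm{P}C^{\mathbb{C}}=\{x\in C^{\mathbb{C}}:x\ne0\}/\mathbb{C}^*$, a complex projective quadric. $L\to\mathrm{P}C$ is the real line bundle whose fiber at $\langle x\rangle$ is the space of real linear functionals on the real line $\langle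 x\rangle$; $L^{\mathbb{C}}\to\mathrm{P}C^{\mathbb{C}}$ is the holomorphic line bundle whose fiber at $\langle x\rangle$ is the space of complex linear functionals on the complex line $\langle x\rangle$. There are natural inclusions $\mathrm{P}C\subset\mathrm{P}C^{\mathbb{C}}$ and $L\subset L^{\mathbb{C}}$ (extending real functionals complex-linearly). For $w\in\mathbb{I}^{\mathbb{C}}$, $s_w$ is the section of $L^{\mathbb{C}}$ whose value at $\langle x\rangle$ is the linear functional on $\langle x\rangle$ sending $x$ to $w\cdot x$. When $w\in\mathbb{I}$, its restriction to $\mathrm{P}C$ is a section of $L$. *)

(* Defs.v *)
From HB Require Import structures.
From mathcomp Require Import all_boot all_order all_algebra.
From mathcomp Require Import complex ring.
From mathcomp Require Import all_classical all_reals all_analysis.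

Set Implicit Arguments.
Unset Strict Implicit.
Unset Printing Implicit Defensive.

Import Order.TTheory GRing.Theory Num.Theory.
Import numFieldNormedType.Exports.

Local Open Scope classical_set_scope.
Local Open Scope complex_scope.
Local Open Scope ring_scope.

(* The algebraic definitions are over a field [K]: taking [K := R] gives the real
   objects and [K := R[i]] their complexifications, with the quadratic form and
   the dot product extended complex-(bi)linearly, since everything is given by
   polynomials with rational coefficients in the coordinates. *)

(* Coordinates along 1, i, j, k. *)
Notation quat K := 'rV[K]_4.
Notation splitoct K := ('rV[K]_4 * 'rV[K]_4)%type.
(* Im(H) + H: the three coordinates along i, j, k, then a quaternion. *)
Notation imoct K := 'rV[K]_(3 + 4).

Section SplitOctonions.
Variable K : numFieldType.

Definition mkquat (a b c d : K) : quat K :=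
  \row_(i < 4) nth 0 [:: a; b; c; d] i.

Definition qcoef (x : quat K) (i : nat) : K := x 0 (inord i).

Definition qmul (x y : quat K) : quat K :=
  let x0 := qcoef x 0 in let x1 := qcoef x 1 in
  let x2 := qcoef x 2 in let x3 := qcoef x 3 in
  let y0 := qcoef y 0 in let y1 := qcoef y 1 in
  let y2 := qcoef y 2 in let y3 := qcoef y 3 in
  mkquat (x0 * y0 - x1 * y1 - x2 * y2 - x3 * y3)
         (x0 * y1 + x1 * y0 + x2 * y3 - x3 * y2)
         (x0 * y2 - x1 * y3 + x2 * y0 + x3 * y1)
         (x0 * y3 + x1 * y2 - x2 * y1 + x3 * y0).

(* Over [K := R[i]] this is the [K]-linear extension of the conjugation of the
   real quaternions: the scalars are not conjugated. *)
Definition qconj (x : quat K) : quat K :=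
  mkquat (qcoef x 0) (- qcoef x 1) (- qcoef x 2) (- qcoef x 3).

Definition qnormsq (x : quat K) : K := qcoef (qmul x (qconj x)) 0.

Definition somul (x y : splitoct K) : splitoct K :=
  let: (a, b) := x in let: (c, d) := y in
  (qmul a c + qmul d (qconj b), qmul (qconj a) d + qmul c b).

Definition soquad (x : splitoct K) : K := qnormsq x.1 - qnormsq x.2.

Definition imoct_so (x : imoct K) : splitoct K :=
  (row_mx (0 : 'rV[K]_1) (lsubmx x), rsubmx x).

Definition imquad (x : imoct K) : K := soquad (imoct_so x).

(* The symmetric bilinear form with [imdot x x = imquad x]. *)
Definition imdot (x y : imoct K) : K :=
  (imquad (x + y) - imquad x - imquad y) / 2.

Lemma qcoef_mk a b c d i : (i < 4)%N ->
  qcoef (mkquat a b c d) i = nth 0 [:: a; b; c; d] i.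
Proof. by move=> lti; rewrite /qcoef mxE inordK. Qed.

Lemma qnormsqE (x : quat K) : qnormsq x = \sum_(i < 4) x 0 i ^+ 2.
Proof.
have xE (i : 'I_4) : true -> x 0 i ^+ 2 = qcoef x i ^+ 2.
  by rewrite /qcoef inord_val.
rewrite (eq_bigr _ xE) !big_ord_recr big_ord0 /= /qnormsq qcoef_mk //=.
by rewrite !qcoef_mk //=; ring.
Qed.

Lemma soquadM (x y : splitoct K) : soquad (somul x y) = soquad x * soquad y.
Proof.
case: x y => [a b] [c d].
have nE (z : quat K) : qnormsq z =
    qcoef z 0 ^+ 2 + qcoef z 1 ^+ 2 + qcoef z 2 ^+ 2 + qcoef z 3 ^+ 2.
  by rewrite /qnormsq qcoef_mk //= !qcoef_mk //=; ring.
have DE (u v : quat K) i : qcoef (u + v) i = qcoef u i + qcoef v i.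
  by rewrite /qcoef mxE.
rewrite /soquad /somul /= !nE !DE /qmul /= !qcoef_mk //=.
ring.
Qed.

Lemma imquadE (x : imoct K) : imquad x =
  \sum_(i < 3) x 0 (lshift 4 i) ^+ 2 - \sum_(i < 4) x 0 (rshift 3 i) ^+ 2.
Proof.
rewrite /imquad /soquad !qnormsqE /=; congr (_ - _); last first.
  by apply: eq_bigr => i _; rewrite mxE.
rewrite -[4%N]/(1 + 3)%N big_split_ord /= big_ord1 row_mxEl mxE expr0n add0r.
by apply: eq_bigr => i _; rewrite row_mxEr mxE.
Qed.

Lemma imdotE (x y : imoct K) : imdot x y =
  \sum_(i < 3) x 0 (lshift 4 i) * y 0 (lshift 4 i)
  - \sum_(i < 4) x 0 (rshift 3 i) * y 0 (rshift 3 i).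
Proof.
rewrite /imdot !imquadE.
rewrite !big_ord_recr !big_ord0 /= !mxE.
by field.
Qed.

Lemma imdotxx x : imdot x x = imquad x.
Proof.
by rewrite imdotE imquadE; congr (_ - _); apply: eq_bigr => i _; rewrite expr2.
Qed.

Lemma imdotC x y : imdot x y = imdot y x.
Proof.
by rewrite !imdotE; congr (_ - _); apply: eq_bigr => i _; rewrite mulrC.
Qed.

Lemma imdotDZr w a x y : imdot w (a *: x + y) = a * imdot w x + imdot w y.
Proof.
rewrite !imdotE !big_ord_recr !big_ord0 /= !mxE.
ring.
Qed.

Lemma imquadZ a x : imquad (a *: x) = a ^+ 2 * imquad x.
Proof.
rewrite !imquadE !big_ord_recr !big_ord0 /= !mxE.
ring.
Qed.

End SplitOctonions.

Section Quadric.
Variable K : numFieldType.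

(* The points <x> of the projective quadric, as the lines of [imoct K] on which
   the quadratic form vanishes. *)
Record quadric : Type := Quadric {
  line :> {vspace imoct K};
  dim_line : \dim line = 1%N;
  line_null : forall x, x \in line -> imquad x = 0 }.

(* Set-theoretic sections of the dual of the tautological line bundle. *)
Definition section : Type :=
  forall p : quadric, 'Hom(subvs_of (line p), K^o).

(* The value of the functional [s <x>] at a vector [x] of the line [p = <x>];
   [vsproj] is the inverse of the inclusion of [p]. *)
Definition section_at (s : section) (p : quadric) (x : imoct K) : K :=
  s p (vsproj (line p) x).

(* The section [s_w]. *)
Definition sec (w : imoct K) : section :=
  fun p => linfun (fun x : subvs_of (line p) => (imdot w (vsval x) : K^o)).

Lemma secE w p (x : subvs_of (line p)) : sec w p x = imdot w (vsval x).
Proof.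
have lin : linear (fun x : subvs_of (line p) => (imdot w (vsval x) : K^o)).
  by move=> a u v; rewrite linearP imdotDZr.
pose f := GRing.isLinear.Build _ _ _ _ _ lin.
pose F : {linear subvs_of (line p) -> K^o} := HB.pack
  (fun x : subvs_of (line p) => (imdot w (vsval x) : K^o)) f.
by rewrite /sec; exact: (lfunE F x).
Qed.

Lemma section_at_sec w p x : x \in line p -> section_at (sec w) p x = imdot w x.
Proof. by move=> px; rewrite /section_at secE vsprojK. Qed.

End Quadric.

Section Holomorphic.
Variable K : numFieldType.

(* The [j]-th standard affine chart of the 6-dimensional projective space,
   together with the corresponding frame of the tautological bundle: [chart j y]
   spans the point with affine coordinates [y], and its [j]-th coordinate
   is 1. *)
Definition chart (j : 'I_(3 + 4)) (y : 'rV[K]_6) : imoct K :=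
  \row_i oapp (y 0) 1 (unlift j i).

(* For [K := R[i]], [differentiable] is complex differentiability. *)
Definition holomorphic_near (F : 'rV[K]_6 -> K^o) (y : 'rV[K]_6) : Prop :=
  \forall z \near y, differentiable F z.

(* In the [j]-th chart and trivialization, a section is a function on a closed
   submanifold of [K^6] (an affine quadric). It is holomorphic when, as usual
   for functions on complex submanifolds, it is locally the restriction of a
   holomorphic function on an open subset of [K^6]. *)
Definition holomorphic_section (t : section K) : Prop :=
  forall (j : 'I_(3 + 4)) (y : 'rV[K]_6), imquad (chart j y) = 0 ->
    exists2 F : 'rV[K]_6 -> K^o, holomorphic_near F y &
      \forall z \near y, forall p : quadric K,
        chart j z \in line p -> section_at t p (chart j z) = F z.

End Holomorphic.

Section Complexification.
Variable R : realType.

Definition cplx (x : imoct R) : imoct R[i] :=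
  map_mx (real_complex R) x.

Lemma imquad_cplx x : imquad (cplx x) = (imquad x)%:C.
Proof.
rewrite !imquadE rmorphB !rmorph_sum /=.
by congr (_ - _); apply: eq_bigr => i _; rewrite mxE rmorphXn.
Qed.

Lemma imdot_cplx x y : imdot (cplx x) (cplx y) = (imdot x y)%:C.
Proof.
rewrite !imdotE rmorphB !rmorph_sum /=.
by congr (_ - _); apply: eq_bigr => i _; rewrite !mxE rmorphM.
Qed.

Lemma cplx_eq0 x : (cplx x == 0) = (x == 0).
Proof.
rewrite /cplx; apply/eqP/eqP => [|->]; last by rewrite map_mx0.
move/matrixP=> x0; apply/matrixP => i j; have := x0 i j.
by rewrite !mxE => -[].
Qed.

(* [vpick p] is a nonzero vector of the line [p]. *)
Definition cplx_line (p : quadric R) : {vspace imoct R[i]} :=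
  <[cplx (vpick (line p))]>%VS.

Lemma dim_cplx_line p : \dim (cplx_line p) = 1%N.
Proof.
by rewrite dim_vline cplx_eq0 vpick0 -dimv_eq0 dim_line.
Qed.

Lemma cplx_line_null p x : x \in cplx_line p -> imquad x = 0.
Proof.
move=> /vlineP[k ->].
by rewrite imquadZ imquad_cplx (line_null (memv_pick _)) mulr0.
Qed.

(* The inclusion of the real quadric in the complex one. *)
Definition cplx_point (p : quadric R) : quadric R[i] :=
  Quadric (dim_cplx_line p) (@cplx_line_null p).

Lemma mem_cplx_point p x : x \in line p -> cplx x \in line (cplx_point p).
Proof.
have: (line p == <[vpick (line p)]>)%VS.
  by rewrite eq_sym eqEdim -memvE memv_pick dim_line dim_vline vpick0
             -dimv_eq0 dim_line.
move=> /eqP -> /vlineP[k ->].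
by rewrite /cplx map_mxZ memvZ // memv_line.
Qed.

(* [t] restricts to [s]: over each real point, the complex functional [t] is the
   complex-linear extension of the real functional [s]. *)
Definition extends (t : section R[i]) (s : section R) : Prop :=
  forall (p : quadric R) (x : imoct R), x \in line p ->
    section_at t (cplx_point p) (cplx x) = (section_at s p x)%:C.

(* The restriction of [s_w] to the real quadric, for a real [w]. *)
Lemma extends_sec w : extends (sec (cplx w)) (sec w).
Proof.
by move=> p x px; rewrite !section_at_sec ?imdot_cplx ?mem_cplx_point.
Qed.

Definition extendable : set (section R) :=
  [set s | exists2 t, holomorphic_section t & extends t s].

End Complexification.

(* Main.v *)
Require Import Defs.
From mathcomp Require Import all_boot all_order all_algebra.
From mathcomp Require Import complex ring lra.
From mathcomp Require Import all_classical all_reals all_analysis.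

Set Implicit Arguments.
Unset Strict Implicit.
Unset Printing Implicit Defensive.

Import Order.TTheory GRing.Theory Num.Theory.
Import numFieldNormedType.Exports.

Local Open Scope classical_set_scope.
Local Open Scope complex_scope.
Local Open Scope ring_scope.

(** The substance is that a holomorphic section t of the dual of the
tautological bundle over the complex quadric is linear along the real points.
Such a section is a function on the null cone, homogeneous of degree 1.

Let u and v be orthogonal null vectors. The plane they span is isotropic, so
it gives a projective line inside the quadric, on which t restricts to a
holomorphic section of O(1). The function f z = t (u + z v) is entire, and
f z = z g (1 / z) with g w = t (v + w u), so f is asymptotic to g 0 * z at
infinity. By a theorem of Liouville type ([entire_affine]) f z = f 0 + g 0 * z,
and z = 1 gives t (u + v) = t u + t v ([cone_fun_add]).

Holomorphic means complex differentiable, so Liouville's theorem rests on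
Goursat's theorem ([goursat]), proved by bisection for closed real 1-forms.
Instead of Cauchy's formula, it is applied to ((f - f 0) / id) o exp, which is
entire and periodic: the mean of (f z - f 0) / z over a circle around 0 does not
depend on the radius ([vertical_mean_const]), tends to the derivative of f at
0 for small circles and to g 0 for large ones ([Re_slope_at_origin]). With every
point taken as the origin, the derivative of f is constant.

The rest is algebra over the reals. A function on the null cone that is
homogeneous and additive on orthogonal null pairs is the dot product with a
vector w ([null_cone_linear]). In hyperbolic coordinates the form is
a . b - c^2 with a and b in 3-dimensional spaces. If c = 0, the vector is the
sum of the orthogonal null vectors (a, 0) and (0, b) of two totally isotropic
spaces, on which the function is linear. Once this linear part is subtracted,
the function is constant on the slice c = 1, any two points of which are
joined by steps along null vectors that are orthogonal to the current point
and have c = 0.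

Conversely s_w is the restriction of the section defined by the
complexification of w, and w is unique since the null cone spans. *)

(** * Integrals of continuous functions over a segment *)

Section SegmentIntegral.
Variable R : realType.
Implicit Types (f g : R -> R) (a b c e k : R).

Definition segint f a b : R := \int[lebesgue_measure]_(x in `[a, b]) f x.

Lemma continuous_segint_integrable f a b : continuous f ->
  lebesgue_measure.-integrable `[a, b] (EFin \o f).
Proof.
move=> cf; apply: continuous_compact_integrable; first exact: segment_compact.
exact: continuous_subspaceT.
Qed.

Lemma segint_cat f a b c : continuous f -> a <= b -> b <= c ->
  segint f a c = segint f a b + segint f b c.
Proof.
move=> cf ab bc; have := @Rintegral_itvB _ f (BLeft a) (BRight c) b.
rewrite !bnd_simp => /(_ (continuous_segint_integrable a c cf) ab bc) h.
rewrite {1}/segint -[LHS](subrK (segint f a b)) {1}/segint h addrC.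
congr (_ + _); rewrite Rintegral_itv_obnd_cbnd//.
apply: integrableS (continuous_segint_integrable b c cf) => //.
by apply: subset_itvr; rewrite bnd_simp.
Qed.

Lemma segintB f g a b : continuous f -> continuous g ->
  segint (fun x => f x - g x) a b = segint f a b - segint g a b.
Proof. by move=> cf cg; apply: RintegralB => //; exact: continuous_segint_integrable. Qed.

(** The only estimate on integrals that Goursat's argument and the final limit
need: with e = 0 it also evaluates integrals of constants. *)
Lemma segint_near_cst f a b k e : continuous f -> a <= b ->
    (forall x, a <= x <= b -> `|f x - k| <= e) ->
  `|segint f a b - k * (b - a)| <= e * (b - a).
Proof.
move=> cf ab fk.
have cc m : continuous (fun _ : R => m : R) by exact: cst_continuous.
have I0 m : segint (fun=> m) a b = m * (b - a).
  rewrite /segint Rintegral_cst//= lebesgue_measure_itv/= lte_fin.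
  case: ltP => //= ba.
  have -> : b = a by apply/eqP; rewrite eq_le ba.
  by rewrite subrr.
have mono f1 f2 : continuous f1 -> continuous f2 ->
    (forall x, a <= x <= b -> f1 x <= f2 x) -> segint f1 a b <= segint f2 a b.
  by move=> c1 c2 h; apply: le_Rintegral => //; exact: continuous_segint_integrable.
rewrite ler_distl -mulrBl -mulrDl -!I0; apply/andP; split; apply: mono => // x /fk.
  by rewrite ler_distl => /andP[].
by rewrite ler_distl => /andP[].
Qed.

End SegmentIntegral.

(** * Goursat's theorem for closed differentiable 1-forms in the plane *)

Section Goursat.
Variable R : realType.

Lemma nested_intervals (l u : nat -> R) :
    (forall n, l n <= l n.+1) -> (forall n, u n.+1 <= u n) ->
    (forall n, l n <= u n) ->
  exists x, forall n, l n <= x <= u n.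
Proof.
move=> lS uS lu.
have {}lS : {homo l : m n / (m <= n)%N >-> m <= n}.
  by apply: homo_leq lS => // y x z; exact: le_trans.
have {}uS : {homo u : m n / (m <= n)%N >-> n <= m}.
  by apply: homo_leq uS => // y x z xy zx; exact: le_trans zx xy.
have lub m n : l m <= u n.
  apply: le_trans (lS _ _ (leq_maxl m n)) _; apply: le_trans (lu _) _.
  exact: uS (leq_maxr m n).
have Lub : has_ubound (range l) by exists (u 0%N) => _ [m _ <-].
exists (sup (range l)) => n; apply/andP; split.
  by apply: ub_le_sup => //; exists n.
by apply: ge_sup; [exists (l 0%N), 0%N | move=> _ [m _ <-]].
Qed.

(** Compactness of a rectangle in the form of bisection: a property inherited at
each stage by some rectangle of half the size inside the current one holds
for rectangles of all stages around one common point. *)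
Lemma quadrisection (w v a b : R) (Bad : nat -> R -> R -> Prop) :
    0 <= w -> 0 <= v ->
    (forall n x y, Bad n x y -> exists x' y', Bad n.+1 x' y' /\
       (x <= x' /\ x' + w / 2 ^+ n.+1 <= x + w / 2 ^+ n) /\
       (y <= y' /\ y' + v / 2 ^+ n.+1 <= y + v / 2 ^+ n)) ->
    Bad 0%N a b ->
  exists x0 y0, forall n, exists x y, Bad n x y /\
    x <= x0 <= x + w / 2 ^+ n /\ y <= y0 <= y + v / 2 ^+ n.
Proof.
move=> w0 v0 step Bad0.
(* The stage is part of the state, so that one relation describes every step. *)
pose T := {s : nat * (R * R) | Bad s.1 s.2.1 s.2.2}.
pose r (s t : T) := let: (n, (x, y)) := sval s in let: (m, (x', y')) := sval t in
   m = n.+1 /\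
   (x <= x' /\ x' + w / 2 ^+ n.+1 <= x + w / 2 ^+ n) /\
   (y <= y' /\ y' + v / 2 ^+ n.+1 <= y + v / 2 ^+ n).
have rP (s : T) : {t | r s t}.
  apply: cid; case: s => -[n [x y]] /= B.
  by have [x' [y' [B' h]]] := step _ _ _ B; exists (exist _ (n.+1, (x', y')) B').
have [f [f0 fS]] := dependent_choice rP (exist _ (0%N, (a, b)) Bad0 : T).
have fn n : (sval (f n)).1 = n.
  elim: n => [|n IH]; first by rewrite f0.
  move: (fS n) IH; rewrite /r.
  by case: (sval (f n)) (sval (f n.+1)) => [i [x y]] [j [x' y']] /= [-> _] ->.
have fS' n : ((sval (f n)).2.1 <= (sval (f n.+1)).2.1 /\
    (sval (f n.+1)).2.1 + w / 2 ^+ n.+1 <= (sval (f n)).2.1 + w / 2 ^+ n) /\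
   ((sval (f n)).2.2 <= (sval (f n.+1)).2.2 /\
    (sval (f n.+1)).2.2 + v / 2 ^+ n.+1 <= (sval (f n)).2.2 + v / 2 ^+ n).
  move: (fS n) (fn n); rewrite /r.
  by case: (sval (f n)) (sval (f n.+1)) => [i [x y]] [j [x' y']] /= [_ h] <-.
have [] := @nested_intervals (fun n => (sval (f n)).2.1)
    (fun n => (sval (f n)).2.1 + w / 2 ^+ n).
- by move=> n; case: (fS' n) => -[].
- by move=> n; case: (fS' n) => -[].
- by move=> n; rewrite lerDl divr_ge0// exprn_ge0.
move=> x0 x0P.
have [] := @nested_intervals (fun n => (sval (f n)).2.2)
    (fun n => (sval (f n)).2.2 + v / 2 ^+ n).
- by move=> n; case: (fS' n) => _ [].
- by move=> n; case: (fS' n) => _ [].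
- by move=> n; rewrite lerDl divr_ge0// exprn_ge0.
move=> y0 y0P.
exists x0, y0 => n; exists (sval (f n)).2.1, (sval (f n)).2.2; split=> //.
by have := svalP (f n); rewrite fn.
Qed.

(** Total differentiability at (x0, y0), with partial derivatives p and q. *)
Definition tdiff (F : R -> R -> R) (x0 y0 p q : R) := forall e : R, 0 < e ->
  exists2 d : R, 0 < d & forall x y, `|x - x0| < d -> `|y - y0| < d ->
    `|F x y - F x0 y0 - p * (x - x0) - q * (y - y0)|
      <= e * (`|x - x0| + `|y - y0|).

Lemma tdiff_continuous (F : R -> R -> R) x0 y0 p q : tdiff F x0 y0 p q ->
  {for x0, continuous (fun x => F x y0)} /\ {for y0, continuous (F x0)}.
Proof.
move=> /(_ 1 ltr01)[d d0 Fd].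
suff H (G : R -> R) (z0 m : R) : (forall z, `|z - z0| < d ->
    `|G z - G z0 - m * (z - z0)| <= `|z - z0|) -> {for z0, continuous G}.
  split; [apply: (H _ _ p) | apply: (H _ _ q)] => z zd.
    have := Fd z y0 zd; rewrite !subrr normr0 !mulr0 subr0 addr0 mul1r; exact.
  have := Fd x0 z; rewrite !subrr normr0 mulr0 subr0 add0r mul1r; exact.
move=> GP; apply/cvgrPdist_le => e e0; apply/nbhs_ballP.
have m0 : 0 < `|m| + 1 by rewrite ltr_wpDl.
exists (Num.min d (e / (`|m| + 1))); first by rewrite /= lt_min d0 divr_gt0.
move=> z; rewrite /ball/= lt_min distrC => /andP[zd ze].
rewrite distrC -(subrK (m * (z - z0)) (G z - G z0)).
apply: le_trans (ler_normD _ _) _; rewrite normrM.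
apply: le_trans (lerD (GP z zd) (lexx _)) _.
by move: ze; rewrite ltr_pdivlMr// => ze; apply/ltW; apply: le_lt_trans ze; lra.
Qed.

Variables P Q : R -> R -> R.
Hypothesis PQ : forall x y, exists p k q, tdiff P x y p k /\ tdiff Q x y k q.

(** The integral of P dx + Q dy along the positively oriented boundary of the
rectangle with lower left corner (x, y), width w and height v. Opposite sides
are put under one integral: on a small rectangle these differences are close
to constants, which cancel for a closed form. *)
Definition boundary_int (x y w v : R) :=
  segint (fun t => P t y - P t (y + v)) x (x + w) +
  segint (fun t => Q (x + w) t - Q x t) y (y + v).

Let cP y : continuous (fun x => P x y).
Proof. by move=> x; have [p [k [q [/tdiff_continuous[]]]]] := PQ x y. Qed.

Let cQ x : continuous (Q x).
Proof. by move=> y; have [p [k [q [_ /tdiff_continuous[]]]]] := PQ x y. Qed.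

Let cPB y y' : continuous (fun x => P x y - P x y').
Proof. by move=> x; apply: cvgB; exact: cP. Qed.

Let cQB x x' : continuous (fun y => Q x y - Q x' y).
Proof. by move=> y; apply: cvgB; exact: cQ. Qed.

Lemma boundary_int_hsplit (x y w1 w2 v : R) : 0 <= w1 -> 0 <= w2 ->
  boundary_int x y (w1 + w2) v =
  boundary_int x y w1 v + boundary_int (x + w1) y w2 v.
Proof.
move=> w10 w20; rewrite /boundary_int addrA.
rewrite (segint_cat (b := x + w1)) ?lerDl//.
rewrite (segintB _ _ (@cQ (x + w1 + w2)) (@cQ x)).
rewrite (segintB _ _ (@cQ (x + w1)) (@cQ x)).
rewrite (segintB _ _ (@cQ (x + w1 + w2)) (@cQ (x + w1))).
by ring.
Qed.

Lemma boundary_int_vsplit (x y w v1 v2 : R) : 0 <= v1 -> 0 <= v2 ->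
  boundary_int x y w (v1 + v2) =
  boundary_int x y w v1 + boundary_int x (y + v1) w v2.
Proof.
move=> w10 w20; rewrite /boundary_int addrA.
rewrite [X in _ + X](segint_cat (b := y + v1)) ?lerDl//.
rewrite (segintB _ _ (@cP y) (@cP (y + v1 + v2))).
rewrite (segintB _ _ (@cP y) (@cP (y + v1))).
rewrite (segintB _ _ (@cP (y + v1)) (@cP (y + v1 + v2))).
by ring.
Qed.

(** Differentiability without continuity of the derivatives is enough. If the
boundary integral had absolute value e > 0, then at stage n of the bisection
some rectangle would keep at least e / 4 ^ n. Around the common point of these
rectangles, the differential contributes k w v - k w v = 0, and the
remainder is an arbitrarily small multiple of the area scale 1 / 4 ^ n. *)
Theorem goursat (a b w v : R) : 0 <= w -> 0 <= v -> boundary_int a b w v = 0.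
Proof.
move=> w0 v0; apply/eqP/negPn/negP => J0.
pose e := `|boundary_int a b w v|.
have e0 : 0 < e by rewrite normr_gt0.
pose Bad n x y :=
  e / 4 ^+ n <= `|boundary_int x y (w / 2 ^+ n) (v / 2 ^+ n)|.
have := @quadrisection w v a b Bad w0 v0.
case.
- move=> n x y.
  have half (c : R) : c / 2 ^+ n = c / 2 ^+ n.+1 + c / 2 ^+ n.+1.
    by rewrite exprSr invfM mulrA -splitr.
  have c0 (c : R) m : 0 <= c -> 0 <= c / 2 ^+ m by move=> ?; rewrite divr_ge0 ?exprn_ge0.
  rewrite {1}/Bad !half boundary_int_hsplit ?c0// !boundary_int_vsplit ?c0//.
  set w' := w / _; set v' := v / _ => h.
  have w'0 : 0 <= w' by exact: c0.
  have v'0 : 0 <= v' by exact: c0.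
  apply/not_existsP => N.
  have {}N x' y' : x' = x \/ x' = x + w' -> y' = y \/ y' = y + v' ->
      `|boundary_int x' y' w' v'| < e / 4 ^+ n.+1.
    move=> hx hy; rewrite ltNge; apply/negP => B.
    apply: (N x'); exists y'; split=> //.
    by case: hx => ->; case: hy => ->; lra.
  have := ler_normD (boundary_int x y w' v' + boundary_int x (y + v') w' v')
      (boundary_int (x + w') y w' v' + boundary_int (x + w') (y + v') w' v').
  have := ler_normD (boundary_int x y w' v') (boundary_int x (y + v') w' v').
  have := ler_normD (boundary_int (x + w') y w' v') (boundary_int (x + w') (y + v') w' v').
  have := N x y; have := N (x + w') y; have := N x (y + v'); have := N (x + w') (y + v').
  move: h; have -> : e / 4 ^+ n = 4 * (e / 4 ^+ n.+1) by rewrite exprSr invfM; lra.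
  move=> h /(_ (or_intror erefl) (or_intror erefl)) h1 /(_ (or_introl erefl) (or_intror erefl)) h2.
  move=> /(_ (or_intror erefl) (or_introl erefl)) h3 /(_ (or_introl erefl) (or_introl erefl)) h4.
  lra.
- by rewrite /Bad !expr0 !divr1.
move=> x0 [y0 near0].
have [p [k [q [dP dQ]]]] := PQ x0 y0.
(* With this choice, the bound 2 e' (w + v)^2 / 4^n found at the end is less
   than e / 4^n. *)
pose S := (w + v) ^+ 2.
have S0 : 0 <= S by rewrite sqr_ge0.
pose e' := e / (2 * S + 1).
have e'0 : 0 < e' by rewrite divr_gt0//; lra.
have [d1 d10 h1] := dP _ e'0.
have [d2 d20 h2] := dQ _ e'0.
have [n [wn1 [vn1 [wn2 vn2]]]] : exists n, w / 2 ^+ n < d1 /\ v / 2 ^+ n < d1 /\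
    w / 2 ^+ n < d2 /\ v / 2 ^+ n < d2.
  have small (c d : R) : 0 < d -> \forall n \near \oo, c / 2 ^+ n < d.
    move=> d0.
    have /cvgrPdist_lt /(_ _ d0) : geometric c 2^-1 @ \oo --> (0 : R).
      by apply: cvg_geometric; rewrite ger0_norm ?invf_lt1// ltr1n.
    apply: filterS => m; rewrite /= sub0r normrN -exprVn.
    by apply: le_lt_trans; exact: ler_norm.
  by near \oo => n; exists n; split; [|split; [|split]]; near: n; exact: small.
have [x [y [B [xx0 yy0]]]] := near0 n.
move: B; rewrite /Bad; apply/negP; rewrite -ltNge.
have w'0 : 0 <= w / 2 ^+ n by rewrite divr_ge0 ?exprn_ge0.
have v'0 : 0 <= v / 2 ^+ n by rewrite divr_ge0 ?exprn_ge0.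
set w' := w / 2 ^+ n in wn1 wn2 xx0 w'0 *; set v' := v / 2 ^+ n in vn1 vn2 yy0 v'0 *.
have near_abs (c c0 l d : R) : c0 <= c <= c0 + l -> c0 <= d <= c0 + l -> `|d - c| <= l.
  by move=> /andP[? ?] /andP[? ?]; rewrite ler_norml; apply/andP; split; lra.
have I1 : `|segint (fun t => P t y - P t (y + v')) x (x + w') - (- k * v') * (x + w' - x)|
    <= (2 * e' * (w' + v')) * (x + w' - x).
  apply: segint_near_cst; [exact: cPB | by rewrite lerDl |].
  move=> t tx.
  have tx0 := near_abs _ _ _ _ xx0 tx.
  have yb : y <= y <= y + v' by rewrite lexx lerDl.
  have yt : y <= y + v' <= y + v' by rewrite lexx lerDl v'0.
  have y1 := near_abs _ _ _ _ yy0 yb; have y2 := near_abs _ _ _ _ yy0 yt.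
  have := h1 t y (le_lt_trans tx0 wn1) (le_lt_trans y1 vn1).
  have := h1 t (y + v') (le_lt_trans tx0 wn1) (le_lt_trans y2 vn1).
  move=> ha hb.
  have {}ha := le_trans ha (ler_wpM2l (ltW e'0) (lerD tx0 y2)).
  have {}hb := le_trans hb (ler_wpM2l (ltW e'0) (lerD tx0 y1)).
  move: ha hb; rewrite !ler_norml => /andP[? ?] /andP[? ?]; apply/andP; split; lra.
have I2 : `|segint (fun t => Q (x + w') t - Q x t) y (y + v') - (k * w') * (y + v' - y)|
    <= (2 * e' * (w' + v')) * (y + v' - y).
  apply: segint_near_cst; [exact: cQB | by rewrite lerDl |].
  move=> t ty.
  have ty0 := near_abs _ _ _ _ yy0 ty.
  have xb : x <= x <= x + w' by rewrite lexx lerDl.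
  have xt : x <= x + w' <= x + w' by rewrite lexx lerDl w'0.
  have x1 := near_abs _ _ _ _ xx0 xb; have x2 := near_abs _ _ _ _ xx0 xt.
  have := h2 x t (le_lt_trans x1 wn2) (le_lt_trans ty0 vn2).
  have := h2 (x + w') t (le_lt_trans x2 wn2) (le_lt_trans ty0 vn2).
  move=> ha hb.
  have {}ha := le_trans ha (ler_wpM2l (ltW e'0) (lerD x2 ty0)).
  have {}hb := le_trans hb (ler_wpM2l (ltW e'0) (lerD x1 ty0)).
  move: ha hb; rewrite !ler_norml => /andP[? ?] /andP[? ?]; apply/andP; split; lra.
rewrite /boundary_int.
set J1 := segint _ _ _ in I1 *; set J2 := segint _ _ _ in I2 *.
have {I1 I2} : `|J1 + J2| <= 2 * e' * (w' + v') ^+ 2.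
  move: I1 I2; rewrite !ler_norml => /andP[? ?] /andP[? ?]; apply/andP; split; lra.
move=> /le_lt_trans; apply.
have -> : (w' + v') ^+ 2 = S / 4 ^+ n.
  rewrite /w' /v' -mulrDl expr_div_n /S -exprM mulnC exprM.
  by congr (_ / _ ^+ n); rewrite -natrX.
rewrite mulrA ltr_pM2r ?invr_gt0 ?exprn_gt0//.
rewrite /e' mulrAC mulrA ltr_pdivrMr; last by lra.
by rewrite mulrC mulrDr mulr1 ltrDl.
Unshelve. all: by end_near. Qed.

End Goursat.

(** * Derivatives as linear approximations *)

Section LinearApproximation.
Variable K : numFieldType.

(** The epsilon-delta form of the derivative, from which a complex derivative can
be compared with real ones; the epsilons live in K, hence for complex K are
positive reals. *)
Definition lin_approx (f : K -> K) (x0 a : K) := forall e : K, 0 < e ->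
  exists2 d : K, 0 < d & forall x, `|x - x0| < d ->
    `|f x - f x0 - a * (x - x0)| <= e * `|x - x0|.

Lemma is_derive_lin_approx (f : K -> K^o) (x0 a : K) :
  is_derive (x0 : K^o) 1 f a <-> lin_approx f x0 a.
Proof.
have shape x : x != 0 ->
    `|a - x^-1 *: (f (x *: 1 + x0) - f x0)| = `|x|^-1 * `|f (x + x0) - f x0 - a * x|.
  move=> xn0; rewrite -normfV -normrM distrC; congr `|_|.
  rewrite /GRing.scale/= mulr1 [RHS]mulrBr [x^-1 * (a * x)]mulrCA mulVf//.
  by rewrite mulr1.
have cvgP : (fun h => h^-1 *: (f (h *: 1 + x0) - f x0)) @ 0^' --> (a : K^o) <->
    lin_approx f x0 a.
  split.
    move=> /cvgrPdist_le H e e0; have [d /= d0 dP] := H e e0.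
    exists d => // x xd; have [->|xx0] := eqVneq x x0.
      by rewrite !subrr mulr0 subr0 normr0 mulr0.
    have xn0 : x - x0 != 0 by rewrite subr_eq0.
    have := dP (x - x0); rewrite /= sub0r normrN => /(_ xd xn0).
    by rewrite shape// subrK ler_pdivrMl ?normr_gt0// [leRHS]mulrC.
  move=> H; apply/cvgrPdist_le => e e0; have [d d0 dP] := H e e0.
  exists d => // x /=; rewrite sub0r normrN => xd xn0.
  rewrite shape// ler_pdivrMl ?normr_gt0// [leRHS]mulrC.
  by have := dP (x + x0); rewrite addrK; exact.
split; first by case=> df da; apply/cvgP; rewrite -da; exact: df.
move=> /cvgP H; split; first by apply/cvg_ex; exists a.
exact: cvg_lim.
Qed.

End LinearApproximation.

(** * The complex exponential *)

Section ComplexExponential.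
Variable R : realType.
Local Notation C := R[i].
Local Notation Re := (@complex.Re R).
Local Notation Im := (@complex.Im R).
Import ComplexField.Normc.
Implicit Types (h f : C -> C) (z a : C).

Lemma normCE z : `|z| = (normc z)%:C. Proof. by []. Qed.

Lemma normc_ge0 z : 0 <= normc z.
Proof. by case: z => x y; exact: sqrtr_ge0. Qed.

Lemma normc_real (x : R) : normc x%:C = `|x|.
Proof. by rewrite /= expr0n addr0 sqrtr_sqr. Qed.

Lemma normcD_ReIm z : normc z <= `|Re z| + `|Im z|.
Proof.
rewrite {1}[z]complexE; apply: le_trans (le_normcD _ _) _.
have i1 : normc ('i%C : C) = 1 by rewrite /= expr0n expr1n add0r sqrtr1.
by rewrite normcM i1 mul1r !normc_real.
Qed.

Lemma ler_Re_normc z : `|Re z| <= normc z.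
Proof.
by case: z => x y /=; rewrite -(sqrtr_sqr x) ler_wsqrtr// lerDl sqr_ge0.
Qed.

Lemma ler_Im_normc z : `|Im z| <= normc z.
Proof.
by case: z => x y /=; rewrite -(sqrtr_sqr y) ler_wsqrtr// lerDr sqr_ge0.
Qed.

Lemma lin_approx_normc h z0 a : lin_approx h z0 a <->
  forall e : R, 0 < e -> exists2 d : R, 0 < d & forall z, normc (z - z0) < d ->
    normc (h z - h z0 - a * (z - z0)) <= e * normc (z - z0).
Proof.
have pos (e : C) : 0 < e -> e = (Re e)%:C /\ 0 < Re e.
  case: e => x y; rewrite ltcE /= => /andP[/eqP -> //].
split=> H e e0.
  have [|d /pos[dE d0] dP] := H e%:C; first by rewrite ltcR.
  exists (Re d) => // z zd; rewrite -lecR rmorphM; apply: dP.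
  by rewrite dE ltcR.
have [eE e'0] := pos _ e0; have [d d0 dP] := H _ e'0.
exists d%:C; first by rewrite ltcR.
by move=> z; rewrite eE !normCE -rmorphM ltcR lecR; exact: dP.
Qed.

(** The Cauchy-Riemann equations, read off the real and imaginary parts of
multiplication by the derivative a. *)
Lemma lin_approx_tdiff h x y a : lin_approx h (x +i* y) a ->
  tdiff (fun s t => Re (h (s +i* t))) x y (Re a) (- Im a) /\
  tdiff (fun s t => Im (h (s +i* t))) x y (Im a) (Re a).
Proof.
move=> /lin_approx_normc H.
suff K (e : R) : 0 < e -> exists2 d : R, 0 < d & forall s t, `|s - x| < d -> `|t - y| < d ->
    normc (h (s +i* t) - h (x +i* y) - a * ((s - x) +i* (t - y))) <= e * (`|s - x| + `|t - y|).
  split=> e e0; have [d d0 dP] := K e e0; exists d => // s t sd td.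
  have := le_trans (ler_Re_normc _) (dP s t sd td).
    clear; move: (h _) (h _) a => [? ?] [? ?] [? ?] /=.
    by congr (is_true (`|_| <= _)); ring.
  have := le_trans (ler_Im_normc _) (dP s t sd td).
    clear; move: (h _) (h _) a => [? ?] [? ?] [? ?] /=.
    by congr (is_true (`|_| <= _)); ring.
move=> e0; have [d d0 dP] := H e e0.
exists (d / 2); first by rewrite divr_gt0.
move=> s t sd td.
have le1 : normc ((s - x) +i* (t - y)) <= `|s - x| + `|t - y| by exact: normcD_ReIm.
have := dP (s +i* t); rewrite /= => /(_ _)/le_trans; apply.
  by apply: le_lt_trans le1 _; rewrite (splitr d) ltrD.
by rewrite ler_pM2l.
Qed.

Definition cexp z : C :=
  (expR (Re z) * cos (Im z)) +i* (expR (Re z) * sin (Im z)).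

Lemma cexpD z z' : cexp (z + z') = cexp z * cexp z'.
Proof.
case: z z' => [x y] [x' y']; rewrite /cexp /= expRD cosD sinD.
by apply/eqP; rewrite eq_complex /=; apply/andP; split; apply/eqP; ring.
Qed.

Lemma cexp_periodic z : cexp (z + 0 +i* (pi *+ 2)) = cexp z.
Proof.
rewrite cexpD {2}/cexp /= expR0 cos2pi sin2pi mulr1 mulr0.
exact: mulr1.
Qed.

Lemma normc_cexp z : normc (cexp z) = expR (Re z).
Proof.
by rewrite /= !exprMn -mulrDr cos2Dsin2 mulr1 sqrtr_sqr ger0_norm ?expR_ge0.
Qed.

Lemma cexp_neq0 z : cexp z != 0.
Proof.
apply/eqP => z0; have := normc_cexp z; rewrite z0 normc0 => /esym/eqP.
by rewrite (gt_eqF (expR_gt0 _)).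
Qed.

(** By the addition formula only the derivative at 0 matters, where the error of
exp (s + i t) against 1 + s + i t is bounded by means of the derivatives at 0
of the real exponential, of cosine and of sine. *)
Lemma lin_approx_cexp z0 : lin_approx cexp z0 (cexp z0).
Proof.
have real_approx (f : R -> R) (x a : R) : is_derive x 1 f a -> lin_approx f x a.
  by move=> ?; apply/is_derive_lin_approx.
apply/lin_approx_normc => e e0.
set c := expR (Re z0).
have c0 : 0 < c by exact: expR_gt0.
(* With r the norm of the increment, the errors found below are at most m r,
   3 m r, 3 m r and 2 r r, so at most 9 m r if r < m. *)
have [m [m0 m1 me]] : exists m : R, [/\ 0 < m, m <= 1 & 9 * m <= e / c].
  exists (Num.min 1 (e / c / 9)); split; first by rewrite lt_min ltr01 !divr_gt0.
    by rewrite ge_min lexx.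
  rewrite mulrC -ler_pdivlMr//.
  by rewrite ge_min lexx orbT.
have [d1 d10 h1] := real_approx _ _ _ (is_derive_expR 0) m m0.
have [d2 d20 h2] := real_approx _ _ _ (is_derive_cos 0) m m0.
have [d3 d30 h3] := real_approx _ _ _ (is_derive_sin 0) m m0.
exists (Num.min (Num.min d1 d2) (Num.min d3 m)); first by rewrite !lt_min d10 d20 d30 m0.
move=> z; rewrite !lt_min => /andP[/andP[zd1 zd2] /andP[zd3 zm]].
have -> : cexp z - cexp z0 - cexp z0 * (z - z0) = cexp z0 * (cexp (z - z0) - 1 - (z - z0)).
  have := cexpD z0 (z - z0); rewrite addrC subrK => ->.
  by rewrite !mulrBr mulr1.
rewrite normcM normc_cexp -/c -ler_pdivlMl// mulrA [c^-1 * e]mulrC.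
move: zd1 zd2 zd3 zm; move: (z - z0) => {z}w; set r := normc w => wd1 wd2 wd3 wm.
have r0 : 0 <= r by exact: normc_ge0.
have := ler_Re_normc w; have := ler_Im_normc w; rewrite -/r => tr sr.
move: h1 => /(_ (Re w)); rewrite subr0 expR0 mul1r => /(_ (le_lt_trans sr wd1)) h1.
move: h2 => /(_ (Im w)); rewrite subr0 cos0 sin0 oppr0 mul0r subr0 => /(_ (le_lt_trans tr wd2)) h2.
move: h3 => /(_ (Im w)); rewrite !subr0 sin0 cos0 mul1r subr0 => /(_ (le_lt_trans tr wd3)) h3.
apply: le_trans (normcD_ReIm _) _.
case: w @r tr sr h1 h2 h3 r0 wd1 wd2 wd3 wm => s t r /= tr sr h1 h2 h3 r0 wd1 wd2 wd3 wm.
rewrite -/r in tr sr wd1 wd2 wd3 wm r0 *.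
have {}h1 : `|expR s - 1 - s| <= m * r by apply: le_trans h1 _; rewrite ler_pM2l.
have {}h2 : `|cos t - 1| <= m * r by apply: le_trans h2 _; rewrite ler_pM2l.
have {}h3 : `|sin t - t| <= m * r by apply: le_trans h3 _; rewrite ler_pM2l.
have mr : m * r <= r by rewrite ler_piMl.
have es1 : `|expR s - 1| <= 2 * r.
  have := ler_normD (expR s - 1 - s) s; rewrite subrK => /le_trans; apply.
  lra.
have es3 : expR s <= 3.
  have := le_trans (ler_norm _) es1; lra.
have -> : expR s * cos t - 1 - s = (expR s - 1 - s) + expR s * (cos t - 1) by ring.
have -> : expR s * sin t - 0 - t = expR s * (sin t - t) + (expR s - 1) * t by ring.
have := ler_normD (expR s - 1 - s) (expR s * (cos t - 1)).
have := ler_normD (expR s * (sin t - t)) ((expR s - 1) * t).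
rewrite !normrM (ger0_norm (expR_ge0 s)).
have l1 : expR s * `|cos t - 1| <= 3 * (m * r) by rewrite ler_pM ?expR_ge0.
have l2 : expR s * `|sin t - t| <= 3 * (m * r) by rewrite ler_pM ?expR_ge0.
have l3 : `|expR s - 1| * `|t| <= 2 * r * r by rewrite ler_pM.
have l4 : r * r <= m * r by rewrite ler_wpM2r// ltW.
have l5 : 9 * m * r <= e / c * r by rewrite ler_wpM2r.
lra.
Qed.

End ComplexExponential.

Section Derivable.
Variable K : numFieldType.
Implicit Types f g : K -> K^o.

Lemma derivable_lin_approx f (x : K) :
  derivable f (x : K^o) 1 <-> exists a, lin_approx f x a.
Proof.
split=> [df|[a /is_derive_lin_approx[]//]].
by exists ('D_1 f (x : K^o)); apply/is_derive_lin_approx; split.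
Qed.

Lemma derivable_comp1 f g (x : K) : derivable f (x : K^o) 1 ->
  derivable g (f x) 1 -> derivable (g \o f : K -> K^o) (x : K^o) 1.
Proof.
move=> /derivable1_diffP df /derivable1_diffP dg.
by apply/derivable1_diffP; apply: differentiable_comp.
Qed.

Lemma lin_approx_shift_scale (f : K -> K) (c y x a : K) :
  lin_approx f (y + x) a -> lin_approx (fun z => c * f (y + z)) x (c * a).
Proof.
move=> df e e0; have c0 : 0 < `|c| + 1 by rewrite ltr_wpDl.
have [d d0 dP] := df (e / (`|c| + 1)) (divr_gt0 e0 c0).
exists d => // z zd; have zx : z - x = (y + z) - (y + x) by rewrite opprD addrACA subrr add0r.
rewrite -mulrA -!mulrBr normrM zx.
have := dP (y + z); rewrite -zx => /(_ zd) /(ler_wpM2l (normr_ge0 c))/le_trans; apply.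
rewrite mulrA ler_wpM2r// mulrCA ler_piMr// ?ltW//.
by rewrite ltr_pdivrMr// mul1r ltrDl.
Qed.

End Derivable.

(** * Entire functions of linear growth *)

Section EntireFunctions.
Variable R : realType.
Local Notation C := R[i].
Local Notation Re := (@complex.Re R).
Local Notation Im := (@complex.Im R).
Import ComplexField.Normc.
Implicit Types (h f : C -> C) (z a L : C).

(** The Cauchy-Riemann equations make Im h dx + Re h dy a closed form. On a
rectangle of height T its integrals over the two horizontal sides cancel by
periodicity, so those over the two vertical sides agree. *)
Lemma vertical_mean_const h (T x x' : R) :
    (forall z, exists a, lin_approx h z a) ->
    0 <= T -> (forall z, h (z + 0 +i* T) = h z) -> x <= x' ->
  segint (fun t => Re (h (x +i* t))) 0 T = segint (fun t => Re (h (x' +i* t))) 0 T.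
Proof.
move=> dh T0 hT xx'.
have cauchy_riemann u t : exists p k q,
    tdiff (fun s t => Im (h (s +i* t))) u t p k /\
    tdiff (fun s t => Re (h (s +i* t))) u t k q.
  have [a /lin_approx_tdiff[dre dim]] := dh (u +i* t).
  by exists (Im a), (Re a), (- Im a).
have cre u : continuous (fun t => Re (h (u +i* t))).
  by move=> t; have [a /lin_approx_tdiff[/tdiff_continuous[]]] := dh (u +i* t).
have w0 : 0 <= x' - x by rewrite subr_ge0.
have := goursat cauchy_riemann x 0 w0 T0.
rewrite /boundary_int add0r [x + _]addrC subrK.
rewrite (segintB _ _ (cre x') (cre x)).
have -> : segint (fun t => Im (h (t +i* 0)) - Im (h (t +i* T))) x x' = 0.
  have -> : (fun t => Im (h (t +i* 0)) - Im (h (t +i* T))) = (fun=> 0 : R).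
    apply/funext => t; have <- : h (t +i* 0) = h (t +i* T).
      by rewrite -hT; congr h; apply/eqP; rewrite eq_complex /= addr0 add0r !eqxx.
    by rewrite subrr.
  have c0 : continuous (fun _ : R => 0 : R) by exact: cst_continuous.
  have z0 (t : R) : x <= t <= x' -> `|(0 : R) - 0| <= 0 by rewrite subr0 normr0.
  by have := segint_near_cst c0 xx' z0; rewrite !mul0r subr0 normr_le0 => /eqP.
by rewrite add0r => /subr0_eq.
Qed.

(** Let phi z = (f z - f 0) / z. The function h = phi o exp is entire and periodic,
and its mean over a vertical period is the mean of phi over a circle around 0.
This mean does not depend on the radius; it tends to the derivative a at
radius 0 and to L at infinite radius. This replaces Cauchy's integral formula,
and working with exp keeps the origin, where phi is singular, out of every
rectangle. *)
Lemma Re_slope_at_origin f a L :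
    (forall z, exists b, lin_approx f z b) -> lin_approx f 0 a ->
    (forall e : R, 0 < e -> exists M : R, forall z, M < normc z ->
      normc (f z - L * z) <= e * normc z) ->
  Re a = Re L.
Proof.
move=> df dfa growth; apply/eqP; rewrite -subr_eq0 -normr_le0.
apply/ler_addgt0Pr => e e0; rewrite add0r.
pose phi z := (f z - f 0) / z.
pose h : C -> C := fun z => phi (cexp z).
pose T : R := pi *+ 2.
have T0 : 0 < T by rewrite mulrn_wgt0 ?pi_gt0.
have dh z : exists b, lin_approx h z b.
  apply/derivable_lin_approx; apply: (derivable_comp1 (g := phi)).
    by apply/derivable_lin_approx; exists (cexp z); exact: lin_approx_cexp.
  apply: derivableM.
    apply: derivableB; last exact: derivable_cst.
    by apply/derivable_lin_approx; exact: df.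
  by apply: derivableV; [exact: cexp_neq0 | exact: derivable_id].
have hT z : h (z + 0 +i* T) = h z by rewrite /h cexp_periodic.
have hc (x t : R) : normc (cexp (x +i* t)) = expR x by rewrite normc_cexp.
have e40 : 0 < e / 4 by rewrite divr_gt0.
move/lin_approx_normc : dfa => /(_ _ e40)[d d0 dP].
have [M MP] := growth _ e40.
(* The small circle lies where f is close to f 0 + a z. *)
pose x := ln (d / 2).
have xd : expR x < d by rewrite lnK ?posrE ?divr_gt0// gtr_pMr// invf_lt1// ltr1n.
(* The large one lies where f is close to L z and f 0 is negligible. *)
pose x' := Num.max x (ln (`|M| + normc (f 0) / (e / 4) + 1)).
have N0 : 0 <= normc (f 0) / (e / 4) by rewrite divr_ge0 ?normc_ge0 ?ltW.
have big : `|M| + normc (f 0) / (e / 4) + 1 <= expR x'.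
  rewrite -[leLHS]lnK; last by rewrite posrE ltr_wpDl// addr_ge0.
  by rewrite ler_expR le_max lexx orbT.
have Mx' : M < expR x'.
  by apply: lt_le_trans big; have := ler_norm M; lra.
have f0x' : normc (f 0) <= e / 4 * expR x'.
  rewrite -ler_pdivrMl// mulrC; apply: le_trans big; have := normr_ge0 M; lra.
have cre u : continuous (fun t => Re (h (u +i* t))).
  by move=> t; have [b /lin_approx_tdiff[/tdiff_continuous[]]] := dh (u +i* t).
have near_a t : `|Re (h (x +i* t)) - Re a| <= e / 4.
  rewrite -raddfB; apply: le_trans (ler_Re_normc _) _.
  have := dP (cexp (x +i* t)); rewrite subr0 hc => /(_ xd).
  rewrite -ler_pdivrMr ?expR_gt0// -(hc x t) -normcV -normcM; congr (is_true (normc _ <= _)).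
  by rewrite mulrBl mulfK ?cexp_neq0.
have near_L t : `|Re (h (x' +i* t)) - Re L| <= e / 4 + e / 4.
  rewrite -raddfB; apply: le_trans (ler_Re_normc _) _.
  have := MP (cexp (x' +i* t)); rewrite hc => /(_ Mx').
  move=> H; have := lerD H f0x'; rewrite -mulrDl -(normcN (f 0)).
  move=> /(le_trans (le_normcD _ _)).
  rewrite -ler_pdivrMr ?expR_gt0// -(hc x' t) -normcV -normcM; congr (is_true (normc _ <= _)).
  by rewrite addrAC mulrBl mulfK ?cexp_neq0.
have Ia := segint_near_cst (cre x) (ltW T0) (fun t _ => near_a t).
have IL := segint_near_cst (cre x') (ltW T0) (fun t _ => near_L t).
rewrite (vertical_mean_const dh (ltW T0) hT (_ : x <= x')) in Ia; last by rewrite le_max lexx.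
rewrite -(ler_pM2r T0); move: Ia IL; rewrite subr0.
have -> : `|Re a - Re L| * T = `|(Re a - Re L) * T|.
  by rewrite normrM (gtr0_norm T0).
set I := segint _ _ _; rewrite !ler_norml.
by move=> /andP[? ?] /andP[? ?]; apply/andP; split; lra.
Qed.

(** Translating f does not change its asymptotic slope L, so every point can play
the role of the origin; multiplication by i turns imaginary parts into real
ones. *)
Lemma entire_slope_constant f L :
    (forall z, exists b, lin_approx f z b) ->
    (forall e : R, 0 < e -> exists M : R, forall z, M < normc z ->
      normc (f z - L * z) <= e * normc z) ->
  forall z, lin_approx f z L.
Proof.
move=> df growth z0.
have [a dfa] := df z0.
suff -> : L = a by [].
have shift c : normc c = 1 -> (forall z, exists b, lin_approx (fun z => c * f (z0 + z)) z b) /\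
    lin_approx (fun z => c * f (z0 + z)) 0 (c * a) /\
    (forall e : R, 0 < e -> exists M : R, forall z, M < normc z ->
      normc (c * f (z0 + z) - (c * L) * z) <= e * normc z).
  move=> c1; split.
    by move=> z; have [b db] := df (z0 + z); exists (c * b); exact: lin_approx_shift_scale.
  split; first by apply: lin_approx_shift_scale; rewrite addr0.
  move=> e e0; have e30 : 0 < e / 3 by rewrite divr_gt0.
  have [M MP] := growth _ e30.
  exists (`|M| + normc z0 + normc (L * z0) / (e / 3)) => z zM.
  rewrite -mulrA -mulrBr normcM c1 mul1r.
  have q0 : 0 <= normc (L * z0) / (e / 3) by rewrite divr_ge0 ?normc_ge0 ?ltW.
  have zz0 : normc z <= normc (z0 + z) + normc z0.
    by rewrite -(normcN z0); apply: le_trans (le_normcD _ _); rewrite addrAC subrr add0r.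
  have Mz : M < normc (z0 + z).
    have := ler_norm M; lra.
  have z1 : normc z0 <= normc z by have := normr_ge0 M; lra.
  have z2 : normc (L * z0) <= normc z * (e / 3).
    by rewrite -ler_pdivrMr//; have := normr_ge0 M; have := normc_ge0 z0; lra.
  have z3 : normc (z0 + z) <= 2 * normc z.
    by apply: le_trans (le_normcD _ _) _; lra.
  have -> : f (z0 + z) - L * z = f (z0 + z) - L * (z0 + z) + L * z0.
    by rewrite mulrDr [L * z0 + _]addrC opprD addrA subrK.
  apply: le_trans (le_normcD _ _) _.
  have z4 : e / 3 * normc (z0 + z) <= e / 3 * (2 * normc z) by rewrite ler_pM2l.
  have := MP _ Mz; lra.
have ReE : Re a = Re L.
  have [h1 [h2 h3]] := shift 1 (normc1 _); have := Re_slope_at_origin h1 h2 h3.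
  by rewrite !mul1r.
have i1 : normc ('i%C : C) = 1 by rewrite /= expr0n expr1n add0r sqrtr1.
have [h1 [h2 h3]] := shift 'i%C i1; have := Re_slope_at_origin h1 h2 h3.
move: ReE; case: (a) (L) => [p q] [p' q'] /= -> .
by rewrite !(mul0r, mul1r, sub0r) => /oppr_inj ->.
Qed.

(** Liouville's theorem for functions asymptotic to L z: the difference with L z
has zero derivative everywhere. *)
Theorem entire_affine f L :
    (forall z, exists b, lin_approx f z b) ->
    (forall e : R, 0 < e -> exists M : R, forall z, M < normc z ->
      normc (f z - L * z) <= e * normc z) ->
  forall z, f z = f 0 + L * z.
Proof.
move=> df growth z.
have dfL := entire_slope_constant df growth.
pose g w := f w - L * w.
have dg w : lin_approx g w 0.
  move=> e e0; have [d d0 dP] := dfL w e e0; exists d => // x xd.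
  have -> : g x - g w - 0 * (x - w) = f x - f w - L * (x - w).
    rewrite /g mul0r subr0 mulrBr !opprB addrACA [RHS]addrACA.
    by congr (_ + _); rewrite addrC.
  exact: dP.
suff gz : g z = g 0 by rewrite -[LHS](subrK (L * z)) -/(g z) gz /g mulr0 subr0.
(* The real-variable constancy criterion applies to both parts of g along the
   segment from 0 to z. *)
suff const (r : C -> R) : (forall w w', r (w - w') = r w - r w') ->
    (forall w, `|r w| <= normc w) -> r (g z) = r (g 0).
  apply/eqP; rewrite eq_complex; apply/andP; split; apply/eqP; apply: const.
  - exact: raddfB.
  - exact: ler_Re_normc.
  - exact: raddfB.
  - exact: ler_Im_normc.
move=> rB r_le; pose G (x : R) := r (g (x%:C * z)).
suff : G 1 = G 0 by rewrite /G mul1r mul0r.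
apply: is_derive_0_is_cst => x; apply/is_derive_lin_approx => e e0.
have k0 : 0 < normc z + 1 by rewrite ltr_wpDl// normc_ge0.
have /lin_approx_normc /(_ _ (divr_gt0 e0 k0))[d d0 dP] := dg (x%:C * z).
exists (d / (normc z + 1)); first by rewrite divr_gt0.
move=> x' x'd; have := dP (x'%:C * z).
rewrite -mulrBl -rmorphB normcM normc_real !mul0r !subr0 => H.
rewrite /G -rB; apply: le_trans (r_le _) _.
apply: le_trans (H _) _.
  apply: le_lt_trans (_ : _ <= `|x' - x| * (normc z + 1)) _.
    by rewrite ler_wpM2l// lerDl.
  by rewrite -ltr_pdivlMr.
rewrite mulrCA [leRHS]mulrC ler_wpM2l// mulrAC ler_pdivrMr//.
by rewrite ler_pM2l// lerDl.
Qed.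

End EntireFunctions.

(** * Sections as homogeneous functions on the null cone *)

Section Cone.
Variable K : numFieldType.
Implicit Types (p q : quadric K) (v : imoct K) (t : section K).

Lemma line_vline p v : v \in line p -> v != 0 -> line p = <[v]>%VS.
Proof.
move=> pv v0; apply/eqP; rewrite eq_sym eqEdim -memvE pv dim_line dim_vline.
by rewrite v0.
Qed.

Lemma quadric_eq p q v : v \in line p -> v \in line q -> v != 0 -> p = q.
Proof.
move=> pv qv v0; have: line p = line q by rewrite (line_vline pv) ?(line_vline qv).
case: p q {pv qv} => [l dl nl] [m dm nm] /= lm; move: dl nl dm nm.
by rewrite -lm => dl nl dm nm; congr Quadric; exact: Prop_irrelevance.
Qed.

Lemma mem_quadric v : v != 0 -> imquad v = 0 -> exists p, v \in line p.
Proof.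
move=> v0 nv.
have dl : \dim <[v]>%VS = 1%N by rewrite dim_vline v0.
have nl x : x \in <[v]>%VS -> imquad x = 0.
  by move=> /vlineP[k ->]; rewrite imquadZ nv mulr0.
by exists (Quadric dl nl); exact: memv_line.
Qed.

Lemma imquad_isotropic (x y : imoct K) a :
  imquad x = 0 -> imquad y = 0 -> imdot x y = 0 -> imquad (x + a *: y) = 0.
Proof.
move=> nx ny xy.
have -> : imquad (x + a *: y) = imquad x + a ^+ 2 * imquad y + 2 * a * imdot x y.
  rewrite !imquadE imdotE !big_ord_recr !big_ord0 /= !mxE.
  by ring.
by rewrite nx ny xy !mulr0 !addr0.
Qed.

(** A section of the dual of the tautological bundle is the same thing as a
homogeneous function of degree 1 on the null cone. At the vertex all lines give
the value 0; off the cone 0 is a default value. *)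
Definition cone_fun t v : K :=
  if pselect (exists p, v \in line p) is left pv
  then section_at t (sval (cid pv)) v else 0.

Lemma section_atZ t p a v : v \in line p ->
  section_at t p (a *: v) = a * section_at t p v.
Proof. by move=> pv; rewrite /section_at !linearZ. Qed.

Lemma section_at0 t p : section_at t p 0 = 0.
Proof. by rewrite /section_at !linear0. Qed.

Lemma cone_funE t p v : v \in line p -> cone_fun t v = section_at t p v.
Proof.
move=> pv; rewrite /cone_fun; case: pselect => [e|[]]; last by exists p.
case: cid => q /= qv; have [->|v0] := eqVneq v 0; first by rewrite !section_at0.
by rewrite (quadric_eq pv qv v0).
Qed.

Lemma cone_fun0 t : cone_fun t 0 = 0.
Proof. by rewrite /cone_fun; case: pselect => // e; exact: section_at0. Qed.

Lemma cone_funZ t a v : imquad v = 0 -> cone_fun t (a *: v) = a * cone_fun t v.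
Proof.
move=> nv; have [->|v0] := eqVneq v 0; first by rewrite scaler0 cone_fun0 mulr0.
have [p pv] := mem_quadric v0 nv.
by rewrite (cone_funE t pv) (cone_funE t (memvZ a pv)) section_atZ.
Qed.

(** The two affine charts of the projective line spanned by u and v: the
homogeneous function restricted to u + z v and to v + z^-1 u. *)
Lemma cone_fun_swap t u v z : z != 0 -> imquad (v + z^-1 *: u) = 0 ->
  cone_fun t (u + z *: v) = z * cone_fun t (v + z^-1 *: u).
Proof.
move=> z0 nvu; rewrite -cone_funZ// scalerDr scalerA mulfV// scale1r.
by rewrite addrC.
Qed.

End Cone.

(** * Holomorphic sections on isotropic planes *)

Section Holomorphic.
Variable K : numFieldType.
Variables (t : section K) (u v : imoct K).
Hypothesis ht : holomorphic_section t.
Hypothesis nullD : forall z : K, imquad (u + z *: v) = 0.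
Hypothesis neq0D : forall z : K, u + z *: v != 0.

(** Near z0 the vector u + z v is its j-th coordinate times the frame vector of the
j-th chart, for a j where u + z0 v has a nonzero coordinate. So the value is
that coordinate times a holomorphic function of the affine coordinates, which
are quotients of affine functions of z. *)
Lemma cone_fun_lin_approx (z0 : K) :
  exists b, lin_approx (fun z => cone_fun t (u + z *: v)) z0 b.
Proof.
apply/derivable_lin_approx.
have [j wj] : exists j, (u + z0 *: v) 0 j != 0.
  apply/existsP; apply: contraNT (neq0D z0); rewrite negb_exists => /forallP H.
  by apply/eqP/rowP => i; rewrite [RHS]mxE; apply/eqP; have := H i; rewrite negbK.
(* The homogeneous and the affine coordinates along the line. *)
pose l j (z : K^o) : K^o := (u + z *: v) 0 j.
pose y (z : K^o) : 'rV[K]_6 := \sum_(k < 6) (l (lift j k) z / l j z) *: delta_mx 0 k.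
have lE i z : l i z = u 0 i + z * v 0 i by rewrite /l !mxE.
have dl i (z : K^o) : differentiable (l i) z.
  have -> : l i = (fun z : K^o => u 0 i + z * v 0 i).
    by apply/funext => z1; exact: lE.
  apply: differentiableD; first exact: differentiable_cst.
  apply: differentiableM; last exact: differentiable_cst.
  exact: ex_diff.
have yE z k : (y z) 0 k = l (lift j k) z / l j z.
  rewrite /y summxE (bigD1 k)//= big1 ?addr0 => [|i ik]; last first.
    by rewrite !mxE eqxx eq_sym (negPf ik) mulr0.
  by rewrite !mxE !eqxx mulr1.
have chartE z : l j z != 0 -> chart j (y z) = (l j z)^-1 *: (u + z *: v).
  move=> lz; apply/rowP => i; rewrite !mxE; case: unliftP => [k ->|->] /=.
    by rewrite yE -lE mulrC.
  by rewrite -lE mulVf.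
have dy : differentiable y z0.
  have -> : y = \sum_(k < 6) (fun z => (l (lift j k) z / l j z) *: (delta_mx 0 k : 'rV[K]_6)).
    by apply/funext => z; rewrite /y fct_sumE.
  apply: differentiable_sum => k; apply: differentiableZl.
  by apply: differentiableM => //; exact: differentiableV.
have null0 : imquad (chart j (y z0)) = 0 by rewrite chartE// imquadZ nullD mulr0.
have [F hF Ft] := ht null0.
have near_z0 : \forall z \near (z0 : K^o), l j z * F (y z) = cone_fun t (u + z *: v).
  have cy : {for z0, continuous y} by exact: differentiable_continuous.
  have cl : {for z0, continuous (l j)} by exact: differentiable_continuous.
  near=> z.
  have lz : l j z != 0 by near: z; exact: (cvgr_neq0 _ cl wj).
  have FzP : forall p, chart j (y z) \in line p -> section_at t p (chart j (y z)) = F (y z).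
    by near: z; exact: (cy _ Ft).
  have uvE : u + z *: v = l j z *: chart j (y z) by rewrite chartE// scalerA divff// scale1r.
  have [p puv] := mem_quadric (neq0D z) (nullD z).
  have pc : chart j (y z) \in line p by rewrite chartE// memvZ.
  by rewrite (cone_funE t puv) uvE section_atZ// FzP.
apply: near_eq_derivable near_z0 _; apply/derivable1_diffP.
apply: differentiableM => //; apply: differentiable_comp => //.
exact: nbhs_singleton hF.
Unshelve. all: by end_near. Qed.

End Holomorphic.

Section ComplexPlanes.
Variable R : realType.
Local Notation C := R[i].
Import ComplexField.Normc.

(** Global sections of O(1) on the projective line: regularity of g at 0 says
that f z = z g (1 / z) is asymptotic to g 0 * z. *)
Lemma two_charts_affine (f g : C -> C) :
    (forall z, exists b, lin_approx f z b) -> (exists b, lin_approx g 0 b) ->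
    (forall z, z != 0 -> f z = z * g z^-1) ->
  forall z, f z = f 0 + g 0 * z.
Proof.
move=> df [b /lin_approx_normc dg] fg; apply: entire_affine => // e e0.
have [d d0 dP] := dg 1 ltr01.
have B0 : 0 < 1 + normc b by rewrite ltr_pwDl// normc_ge0.
exists (Num.max d^-1 ((1 + normc b) / e)) => z; rewrite gt_max => /andP[zd ze].
have nz0 : 0 < normc z by apply: lt_trans zd; rewrite invr_gt0.
have z0 : z != 0 by apply: contraTneq nz0 => ->; rewrite normc0 ltxx.
rewrite fg// [g 0 * z]mulrC -mulrBr normcM mulrC ler_wpM2r ?normc_ge0//.
have := dP z^-1; rewrite subr0 normcV invf_plt ?posrE// => /(_ zd) H.
have : normc (g z^-1 - g 0) <= (1 + normc b) * (normc z)^-1.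
  rewrite -(subrK (b * z^-1) (g z^-1 - g 0)); apply: le_trans (le_normcD _ _) _.
  by rewrite normcM normcV mulrDl lerD.
move=> /le_trans; apply; rewrite ler_pdivrMr// mulrC -ler_pdivrMr//.
exact: ltW.
Qed.

Variables (t : section C) (u v : imoct C).
Hypothesis ht : holomorphic_section t.

(** Orthogonal null vectors span an isotropic plane, hence a projective line in
the quadric, on which the section restricts to a section of O(1). *)
Lemma cone_fun_add :
    imquad u = 0 -> imquad v = 0 -> imdot u v = 0 ->
  cone_fun t (u + v) = cone_fun t u + cone_fun t v.
Proof.
move=> nu nv uv.
have [v0|v0] := eqVneq v 0; first by rewrite v0 addr0 cone_fun0 addr0.
have [[a uE]|indep] := pselect (exists a, u = a *: v).
  rewrite uE -{2}[v]scale1r -scalerDl !cone_funZ//.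
  by rewrite mulrDl mul1r.
have vu : imdot v u = 0 by rewrite imdotC.
have n1 z : imquad (u + z *: v) = 0 by exact: imquad_isotropic.
have n2 z : imquad (v + z *: u) = 0 by exact: imquad_isotropic.
have i1 z : u + z *: v != 0.
  by apply: contra_notN indep => /eqP/addr0_eq h; exists (- z); rewrite scaleNr -h opprK.
have i2 z : v + z *: u != 0.
  apply/eqP => /addr0_eq h; apply: indep; exists (- z^-1).
  have z0 : z != 0.
    by apply/eqP => z0; move: v0; rewrite -[v]opprK h z0 scale0r oppr0 eqxx.
  by rewrite scaleNr -scalerN h scalerA mulVf// scale1r.
have df z : exists b, lin_approx (fun z => cone_fun t (u + z *: v)) z b.
  exact: cone_fun_lin_approx.
have dg : exists b, lin_approx (fun z => cone_fun t (v + z *: u)) 0 b.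
  exact: cone_fun_lin_approx.
have := two_charts_affine df dg _ 1.
rewrite /= mulr1 !scale0r !addr0 scale1r; apply=> z z0.
exact: cone_fun_swap.
Qed.

End ComplexPlanes.

(** * Linearity of additive functions on a split null cone *)

Section DotProduct.
Variables (K : numFieldType) (n : nat).
Implicit Types a b u : 'rV[K]_n.

Definition dotv a b : K := \sum_i a 0 i * b 0 i.

Lemma dotvC a b : dotv a b = dotv b a.
Proof. by apply: eq_bigr => i _; rewrite mulrC. Qed.

Lemma dotvDl a b u : dotv (a + b) u = dotv a u + dotv b u.
Proof. by rewrite -big_split; apply: eq_bigr => i _; rewrite mxE mulrDl. Qed.

Lemma dotvZl k a u : dotv (k *: a) u = k * dotv a u.
Proof. by rewrite mulr_sumr; apply: eq_bigr => i _; rewrite mxE mulrA. Qed.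

Lemma dotvNl a u : dotv (- a) u = - dotv a u.
Proof. by rewrite -scaleN1r dotvZl mulN1r. Qed.

Lemma dotvDr a b u : dotv u (a + b) = dotv u a + dotv u b.
Proof. by rewrite !(dotvC u) dotvDl. Qed.

Lemma dotvZr k a u : dotv u (k *: a) = k * dotv u a.
Proof. by rewrite !(dotvC u) dotvZl. Qed.

Lemma dotvNr a u : dotv u (- a) = - dotv u a.
Proof. by rewrite !(dotvC u) dotvNl. Qed.

Lemma dotv0l a : dotv 0 a = 0.
Proof. by rewrite -(scale0r 0) dotvZl mul0r. Qed.

Lemma dotv0r a : dotv a 0 = 0.
Proof. by rewrite dotvC dotv0l. Qed.

Lemma dotv_delta a i : dotv (delta_mx 0 i) a = a 0 i.
Proof.
rewrite /dotv (bigD1 i)//= big1 ?addr0 => [|j ji]; first by rewrite mxE !eqxx mul1r.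
by rewrite mxE (negPf ji) andbF mul0r.
Qed.

Definition dotvE := (dotvDl, dotvDr, dotvZl, dotvZr, dotvNl, dotvNr, dotv0l, dotv0r).

(** To be applied on two totally isotropic spaces, where additivity on orthogonal
null pairs is additivity without restriction. *)
Lemma linear_dotv (f : 'rV[K]_n -> K) :
    (forall k a, f (k *: a) = k * f a) -> (forall a b, f (a + b) = f a + f b) ->
  exists u, forall a, f a = dotv u a.
Proof.
move=> fZ fD; exists (\row_i f (delta_mx 0 i)) => a.
have f0 : f 0 = 0 by rewrite -(scale0r 0) fZ mul0r.
have fS (I : Type) (r : seq I) F : f (\sum_(i <- r) F i) = \sum_(i <- r) f (F i).
  by elim/big_ind2 : _ => // x1 x2 y1 y2 <- <-.
rewrite {1}[a]row_sum_delta fS; apply: eq_bigr => i _.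
by rewrite fZ mxE mulrC.
Qed.

End DotProduct.

Section HyperbolicModel.
Variable K : numFieldType.
Variable h : 'rV[K]_3 -> 'rV[K]_3 -> K -> K.
Implicit Types a b : 'rV[K]_3.
Hypothesis hZ : forall k a b c, dotv a b = c ^+ 2 ->
  h (k *: a) (k *: b) (k * c) = k * h a b c.
Hypothesis hD : forall a b c a' b' c', dotv a b = c ^+ 2 -> dotv a' b' = c' ^+ 2 ->
  dotv a b' + dotv a' b = 2 * (c * c') ->
  h (a + a') (b + b') (c + c') = h a b c + h a' b' c'.

(** When c = 0, the null condition dotv a b = 0 says that the components (a, 0)
and (0, b), each in a totally isotropic space, are orthogonal to each other. *)
Lemma hyperbolic_split : exists u v, forall a b, dotv a b = 0 ->
  h a b 0 = dotv u a + dotv v b.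
Proof.
have hZ0 k a b : dotv a b = 0 -> h (k *: a) (k *: b) 0 = k * h a b 0.
  by move=> ab; rewrite -{1}(mulr0 k) hZ// expr0n.
have hD0 a b a' b' : dotv a b = 0 -> dotv a' b' = 0 -> dotv a b' + dotv a' b = 0 ->
    h (a + a') (b + b') 0 = h a b 0 + h a' b' 0.
  by move=> ? ? ?; rewrite -{1}(addr0 0) hD// ?expr0n// !mulr0.
have [u uE] : exists u, forall a, h a 0 0 = dotv u a.
  apply: linear_dotv => [k a|a a']; first by rewrite -hZ0 ?dotv0r// scaler0.
  by rewrite -hD0 ?dotv0r ?addr0.
have [v vE] : exists v, forall b, h 0 b 0 = dotv v b.
  apply: linear_dotv => [k b|b b']; first by rewrite -hZ0 ?dotv0l// scaler0.
  by rewrite -hD0 ?dotv0l ?addr0.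
by exists u, v => a b ab; rewrite -uE -vE -hD0 ?dotv0l ?dotv0r ?addr0 ?add0r.
Qed.

(** On the slice c = 1, a null vector may be moved by any vector of the slice c = 0
that is null and orthogonal to it, and the value does not change. Moving only
a, or only b, within dotv a b = 1 connects any two points of the slice;
homogeneity covers the other values of c. *)
Lemma slice_constant : (forall a b, dotv a b = 0 -> h a b 0 = 0) ->
  exists k, forall a b c, dotv a b = c ^+ 2 -> h a b c = k * c.
Proof.
move=> h0.
have movea a a' b : dotv a b = 1 -> dotv a' b = 1 -> h a b 1 = h a' b 1.
  move=> ab a'b.
  have -> : h a' b 1 = h (a + (a' - a)) (b + 0) (1 + 0).
    by rewrite addrC subrK !addr0.
  rewrite hD; first by rewrite h0 ?addr0// dotv0r.
  - by rewrite ab expr1n.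
  - by rewrite dotv0r expr0n.
  - by rewrite !dotvE ab a'b subrr !mulr0 addr0.
have moveb a b b' : dotv a b = 1 -> dotv a b' = 1 -> h a b 1 = h a b' 1.
  move=> ab ab'.
  have -> : h a b' 1 = h (a + 0) (b + (b' - b)) (1 + 0).
    by rewrite [b + _]addrC subrK !addr0.
  rewrite hD; first by rewrite h0 ?addr0// dotv0l.
  - by rewrite ab expr1n.
  - by rewrite dotv0l expr0n.
  - by rewrite !dotvE ab ab' subrr !mulr0 addr0.
(* Every point of the slice is connected to (e0, e0): directly through some a'
   that pairs to 1 with both b and e0, when b is not a multiple of e0. *)
pose e i : 'rV[K]_3 := delta_mx 0 i.
have ee i j : dotv (e i) (e j) = (i == j)%:R.
  by rewrite dotv_delta mxE eqxx/= eq_sym.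
pose o1 : 'I_3 := lift ord0 ord0.
have o10 : (o1 == ord0) = false by [].
have conn1 i a b : i != ord0 -> b 0 i != 0 -> dotv a b = 1 -> h a b 1 = h (e ord0) (e ord0) 1.
  move=> i0 bi ab.
  pose a' := e ord0 + ((1 - b 0 ord0) / b 0 i) *: e i.
  have a'b : dotv a' b = 1 by rewrite !dotvE !dotv_delta mulfVK// addrC subrK.
  have a'e : dotv a' (e ord0) = 1 by rewrite !dotvE !ee eqxx (negPf i0) mulr0 addr0.
  have e00 : dotv (e ord0) (e ord0) = 1 by rewrite ee eqxx.
  by rewrite (movea a a')// (moveb a' b (e ord0))// (movea a' (e ord0)).
have conn a b : dotv a b = 1 -> h a b 1 = h (e ord0) (e ord0) 1.
  move=> ab; have [/existsP[i /andP[i0 bi]]|] := boolP [exists i, (i != ord0) && (b 0 i != 0)].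
    exact: conn1 bi ab.
  rewrite negb_exists => /forallP bz.
  have bE : b = b 0 ord0 *: e ord0.
    apply/rowP => i; rewrite !mxE eqxx /=; have := bz i; rewrite negb_and !negbK.
    by case: eqVneq => [->|i0] /=; rewrite ?mulr1 ?mulr0// => /eqP.
  have b0 : b 0 ord0 != 0.
    by apply: contra_eq_neq ab => b0; rewrite bE b0 scale0r dotv0r eq_sym oner_neq0.
  (* A multiple of e0 is first moved to e1. *)
  pose a' := (b 0 ord0)^-1 *: e ord0 + e o1.
  have a'b : dotv a' b = 1.
    by rewrite bE /a' !dotvE !ee eqxx o10 addr0 mulr1 mulfV.
  have a'e : dotv a' (e o1) = 1 by rewrite /a' !dotvE !ee eqxx eq_sym o10 mulr0 add0r.
  rewrite (movea a a')// (moveb a' b (e o1))//.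
  by apply: (conn1 o1) => //; rewrite mxE !eqxx oner_neq0.
exists (h (e ord0) (e ord0) 1) => a b c abc.
have [c0|c0] := eqVneq c 0.
  by rewrite c0 mulr0 h0// abc c0 expr0n.
have ab1 : dotv (c^-1 *: a) (c^-1 *: b) = 1 ^+ 2.
  by rewrite !dotvE abc expr1n expr2 mulKf// mulVf.
have := @hZ c _ _ _ ab1; rewrite !scalerA mulfV// !scale1r mulr1 => ->.
by rewrite conn ?ab1 ?expr1n// mulrC.
Qed.

End HyperbolicModel.

Section NullCone.
Variable K : numFieldType.
Implicit Types (a b : 'rV[K]_3) (v : imoct K).

(** The decomposition of the signature (3, 4) into three hyperbolic planes and an
anisotropic line: a and b are coordinates in two totally isotropic spaces in
duality, c is the coordinate on the line. *)
Definition hyp a b (c : K) : imoct K :=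
  row_mx (2^-1 *: (a + b)) (row_mx (2^-1 *: (a - b)) c%:M : 'rV_(3 + 1)).

Lemma hypP v : exists a b c, v = hyp a b c.
Proof.
pose x : 'rV_3 := lsubmx v; pose y : 'rV_(3 + 1) := rsubmx v.
exists (x + lsubmx y), (x - lsubmx y), (rsubmx y 0 0); rewrite /hyp.
have half (u u' : 'rV[K]_3) :
    (2^-1 *: (u + u' + (u - u')) = u) * (2^-1 *: (u + u' - (u - u')) = u').
  by split; apply/rowP => i; rewrite !mxE; field.
by rewrite !half -mx11_scalar !hsubmxK.
Qed.

Lemma hypZ k a b c : k *: hyp a b c = hyp (k *: a) (k *: b) (k * c).
Proof.
rewrite /hyp scale_row_mx; congr row_mx.
  by rewrite -scalerDr !scalerA mulrC.
rewrite (@scale_row_mx _ 1 3 1) scale_scalar_mx -scalerBr !scalerA.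
by rewrite [k * 2^-1]mulrC.
Qed.

Lemma hypD a b c a' b' c' :
  hyp a b c + hyp a' b' c' = hyp (a + a') (b + b') (c + c').
Proof.
rewrite /hyp add_row_mx (@add_row_mx _ 1 3 1) -!scalerDr addrACA.
congr row_mx; apply: (congr2 (@row_mx _ 1 3 1)).
  by rewrite opprD addrACA.
by rewrite raddfD.
Qed.

Lemma imdot_hyp a b c a' b' c' : imdot (hyp a b c) (hyp a' b' c') =
  2^-1 * (dotv a b' + dotv a' b) - c * c'.
Proof.
have rowE (x x' : 'rV[K]_3) (y y' : 'rV[K]_(3 + 1)) :
    imdot (row_mx x y : imoct K) (row_mx x' y') = dotv x x' - dotv y y'.
  rewrite imdotE; congr (_ - _); apply: eq_bigr => i _.
    by rewrite !row_mxEl.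
  by rewrite !row_mxEr.
have yE (y y' : 'rV[K]_3) : dotv (row_mx y c%:M) (row_mx y' c'%:M) = dotv y y' + c * c'.
  rewrite /dotv big_split_ord /= big_ord1 !row_mxEr !mxE !mulr1n; congr (_ + _).
  by apply: eq_bigr => i _; rewrite !row_mxEl.
rewrite /hyp rowE yE !dotvE (dotvC b a') (dotvC b b').
by field.
Qed.

Lemma imquad_hyp a b c : imquad (hyp a b c) = dotv a b - c ^+ 2.
Proof. by rewrite -imdotxx imdot_hyp expr2; field. Qed.

(** In hyperbolic coordinates the values with c = 0 determine a linear functional;
once it is subtracted, what remains is a multiple of c. *)
Theorem null_cone_linear (f : imoct K -> K) :
    (forall k v, imquad v = 0 -> f (k *: v) = k * f v) ->
    (forall u v, imquad u = 0 -> imquad v = 0 -> imdot u v = 0 ->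
      f (u + v) = f u + f v) ->
  exists w, forall v, imquad v = 0 -> f v = imdot w v.
Proof.
move=> fZ fD.
pose h a b c := f (hyp a b c).
have null a b c : dotv a b = c ^+ 2 -> imquad (hyp a b c) = 0.
  by move=> abc; rewrite imquad_hyp abc subrr.
have hZ k a b c : dotv a b = c ^+ 2 -> h (k *: a) (k *: b) (k * c) = k * h a b c.
  by move=> abc; rewrite /h -hypZ fZ// null.
have hD a b c a' b' c' : dotv a b = c ^+ 2 -> dotv a' b' = c' ^+ 2 ->
    dotv a b' + dotv a' b = 2 * (c * c') ->
    h (a + a') (b + b') (c + c') = h a b c + h a' b' c'.
  move=> abc abc' aabb; rewrite /h -hypD fD ?null//.
  by rewrite imdot_hyp aabb mulKf ?subrr// pnatr_eq0.
have [x [y xyE]] := hyperbolic_split hZ hD.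
pose h1 a b c := h a b c - dotv x a - dotv y b.
have [] := @slice_constant _ h1.
- by move=> k a b c abc; rewrite /h1 hZ// !dotvE; ring.
- by move=> a b c a' b' c' abc abc' aabb; rewrite /h1 hD// !dotvE; ring.
- by move=> a b ab; rewrite /h1 xyE//; ring.
move=> k kE; exists (hyp (2 *: y) (2 *: x) (- k)) => v.
have [a [b [c ->]]] := hypP v; rewrite imquad_hyp => /subr0_eq abc.
rewrite imdot_hyp !dotvE (dotvC a x).
have := kE a b c abc; rewrite /h1 => /eqP; rewrite !subr_eq => /eqP; rewrite /h => ->.
by field.
Qed.

End NullCone.

(** * Sections of the form s_w and their extension *)

Section Sections.
Variable K : numFieldType.

(** The null cone spans the whole space. *)
Lemma null_separate (w w' : imoct K) :
  (forall v, imquad v = 0 -> imdot w v = imdot w' v) -> w = w'.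
Proof.
have [a [b [c ->]]] := hypP w; have [a' [b' [c' ->]]] := hypP w' => H.
have aa : a = a'.
  apply/rowP => i; have := H (hyp 0 (delta_mx 0 i) 0).
  rewrite imquad_hyp dotv0l expr0n subrr => /(_ erefl).
  rewrite !imdot_hyp !dotv0l !mulr0 !subr0 !addr0 !(dotvC _ (delta_mx _ _)) !dotv_delta.
  by apply: mulfI; rewrite invr_eq0 pnatr_eq0.
have bb : b = b'.
  apply/rowP => i; have := H (hyp (delta_mx 0 i) 0 0).
  rewrite imquad_hyp dotv0r expr0n subrr => /(_ erefl).
  rewrite !imdot_hyp !dotv0r !mulr0 !subr0 !add0r !dotv_delta.
  by apply: mulfI; rewrite invr_eq0 pnatr_eq0.
have := H (hyp (delta_mx 0 ord0) (delta_mx 0 ord0) 1).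
rewrite imquad_hyp dotv_delta mxE eqxx expr1n subrr => /(_ erefl).
by rewrite !imdot_hyp aa bb !mulr1 => /addrI/oppr_inj ->.
Qed.

Lemma section_eq_sec (s : section K) w :
  (forall v, imquad v = 0 -> cone_fun s v = imdot w v) -> s = sec w.
Proof.
move=> sw; apply/functional_extensionality_dep => p; apply/lfunP => x.
rewrite secE -sw; last exact: line_null (subvsP x).
by rewrite (cone_funE s (subvsP x)) /section_at vsvalK.
Qed.

(** In a chart the section s_w is an affine function of the coordinates, defined on
all of affine space. *)
Lemma holomorphic_sec (w : imoct K) : holomorphic_section (sec w).
Proof.
move=> j y _; exists (fun z => imdot w (chart j z)); last first.
  by near=> z => p pz; rewrite section_at_sec.
near=> z.
have dc i : differentiable (fun z : 'rV[K]_6 => chart j z 0 i : K^o) z.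
  have -> : (fun z : 'rV[K]_6 => chart j z 0 i : K^o) =
            (fun z => oapp (z 0) 1 (unlift j i)).
    by apply/funext => z1; rewrite mxE.
  case: unliftP => [k _|_] /=; first exact: differentiable_coord.
  exact: differentiable_cst.
have dS n (i : 'I_n -> 'I_(3 + 4)) :
    differentiable (fun z => \sum_(k < n) w 0 (i k) * chart j z 0 (i k) : K^o) z.
  have -> : (fun z => \sum_(k < n) w 0 (i k) * chart j z 0 (i k) : K^o) =
      \sum_(k < n) (fun z => w 0 (i k) * chart j z 0 (i k) : K^o).
    by apply/funext => z1; rewrite fct_sumE.
  apply: differentiable_sum => k; apply: differentiableM; last exact: dc.
  exact: differentiable_cst.
have -> : (fun z => imdot w (chart j z) : K^o) = (fun z =>
    (\sum_(k < 3) w 0 (lshift 4 k) * chart j z 0 (lshift 4 k) : K^o) -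
    (\sum_(k < 4) w 0 (rshift 3 k) * chart j z 0 (rshift 3 k) : K^o)).
  by apply/funext => z1; rewrite imdotE.
by apply: differentiableB; exact: dS.
Unshelve. all: by end_near. Qed.

Lemma sec_linear (a : K) (u v : imoct K) p :
  sec (a *: u + v) p = a *: sec u p + sec v p.
Proof.
apply/lfunP => x; rewrite add_lfunE scale_lfunE !secE.
by rewrite imdotC imdotDZr !(imdotC (vsval x)).
Qed.

Lemma sec_inj : injective (@sec K).
Proof.
move=> w w' ww'; apply: null_separate => v nv.
have [->|v0] := eqVneq v 0.
  by rewrite -(scale0r 0) !imdotE !big1 ?subrr// => i _; rewrite scale0r mxE mulr0.
have [p pv] := mem_quadric v0 nv.
by rewrite -!(section_at_sec _ pv) ww'.
Qed.

End Sections.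

Section Real.
Variable R : realType.

Lemma cone_fun_cplx (t : section R[i]) (s : section R) v :
  extends t s -> imquad v = 0 -> cone_fun t (cplx v) = (cone_fun s v)%:C.
Proof.
move=> ts nv; have [->|v0] := eqVneq v 0.
  by rewrite /cplx map_mx0 !cone_fun0.
have [p pv] := mem_quadric v0 nv.
by rewrite (cone_funE s pv) -ts// (cone_funE t (mem_cplx_point pv)).
Qed.

(** Additivity on orthogonal null pairs descends from the complex cone to the real
one, and is all that the extension is used for. *)
Lemma extendable_sec (t : section R[i]) (s : section R) :
  holomorphic_section t -> extends t s -> exists w, s = sec w.
Proof.
move=> ht ts.
have [|u v nu nv uv|w wE] := @null_cone_linear R (cone_fun s).
- exact: cone_funZ.
- have nuv : imquad (u + v) = 0 by rewrite -[v]scale1r imquad_isotropic.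
  apply: complexI; rewrite rmorphD /= -!(cone_fun_cplx ts)//.
  rewrite /cplx map_mxD cone_fun_add//.
  + by rewrite -/(cplx u) imquad_cplx nu.
  + by rewrite -/(cplx v) imquad_cplx nv.
  + by rewrite -/(cplx u) -/(cplx v) imdot_cplx uv.
by exists w; exact: section_eq_sec.
Qed.

End Real.

Theorem theorem18 (R : realType) :
  [/\ forall s : section R,
        (exists2 t : section R[i], holomorphic_section t & extends t s) <->
        (exists w : imoct R, s = sec w),
      forall w w' : imoct R, sec w = sec w' -> w = w',
      forall (a : R) (u v : imoct R) (p : quadric R),
        sec (a *: u + v) p = a *: sec u p + sec v p
    & set_bij [set: imoct R] (@extendable R) (@sec R)].
Proof.
have extP (w : imoct R) : exists2 t, holomorphic_section t & extends t (sec w).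
  by exists (sec (cplx w)); [exact: holomorphic_sec | exact: extends_sec].
split.
- move=> s; split=> [[t ht ts]|[w ->]]; [exact: extendable_sec ht ts | exact: extP].
- exact: sec_inj.
- exact: sec_linear.
split=> [w _|w w' _ _|s [t ht ts]].
- exact: extP.
- exact: sec_inj.
- by have [w ->] := extendable_sec ht ts; exists w.
Qed.
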